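(* Let $M$ be a smooth manifold with an affine connection (covariant differentiation) $\nabla$, curvature operator $R$ and torsion $T$. For all smooth vector fields $A,B,C,D$ on $M$, $$\bigl\{(R(A,B))(T(C,D))-(R(A,B)T)(C,D)-T(R(A,B)C,D)-T(C,R(A,B)D)\bigr\}_{<A,B,C,D>}=0 .$$
   Context: For vector fields $A,B$ put $[A,B]_-:=A\circ B-B\circ A$, $R(A,B):=\nabla_A\circ\nabla_B-\nabla_B\circ\nabla_A-\nabla_{[A,B]_-}$ and $T(A,B):=\nabla_AB-\nabla_BA-[A,B]_-$. The operator $R(A,B)$, formed with the extension of $\nabla$ to tensor fields, acts on all tensor fields; $R(A,B)T:=\nabla_A\nabla_BT-\nabla_B\nabla_AT-\nabla_{[A,B]_-}T$ is its action on the torsion tensor $T$, where $\nabla_A$ acts on tensors of type $(1,2)$ by $(\nabla_AT)(C,D)=\nabla_A(T(C,D))-T(\nabla_AC,D)-T(C,\nabla_AD)$. The notation $\{\ldots\}_{<A,B,C,D>}$ means the sum of the four expressions obtained from $\{\ldots\}$ by the cyclic permutations of $(A,B,C,D)$. *)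

(* Defs.v *)
From HB Require Import structures.
From mathcomp Require Import all_boot all_order all_algebra ring.
From mathcomp Require Import all_classical all_reals all_analysis.

Set Implicit Arguments.
Unset Strict Implicit.
Unset Printing Implicit Defensive.

Import Order.TTheory GRing.Theory Num.Theory.
Import numFieldNormedType.Exports.

Local Open Scope classical_set_scope.
Local Open Scope ring_scope.

Section SmoothOn.
Context {R : realType} {n : nat}.
Implicit Types (U : set 'rV[R]_n) (f g : 'rV[R]_n -> R).

(* C^k on an open set U: f and all its iterated partial derivatives up to
   order k exist and are continuous at every point of U.  The values of f
   outside U are irrelevant. *)
Fixpoint Ck_on U (k : nat) f : Prop :=
  (forall x, U x -> {for x, continuous f}) /\
  if k is k'.+1 then
    forall i : 'I_n,
      (forall x, U x -> derivable f x (delta_mx 0 i)) /\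
      Ck_on U k' (fun x => 'D_(delta_mx 0 i) f x)
  else True.

Definition smooth_on U f : Prop := forall k, Ck_on U k f.

Lemma Ck_onW U k f : Ck_on U k.+1 f -> Ck_on U k f.
Proof.
elim: k f => [|k IH] f; first by case.
move=> [cf df]; split=> // i; have [dfi sfi] := df i.
by split=> //; exact: IH.
Qed.

Lemma near_open U (P : 'rV[R]_n -> Prop) x :
  open U -> U x -> (forall y, U y -> P y) -> \near x, P x.
Proof. by move=> oU Ux UP; exact: filterS UP (open_nbhs_nbhs (conj oU Ux)). Qed.

Lemma Ck_on_ext U k f g : open U -> (forall x, U x -> f x = g x) ->
  Ck_on U k f -> Ck_on U k g.
Proof.
move=> oU; elim: k f g => [|k IH] f g fg [cf df]; split=> //.
1,2: move=> x Ux; rewrite /prop_for /continuous_at -(fg x Ux);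
  have fgx : \near x, f x = g x by exact: near_open oU Ux fg.
1,2: exact: cvg_trans (near_eq_cvg fgx) (cf x Ux).
move=> i; have [dfi sfi] := df i.
have fgx x (Ux : U x) : \near x, f x = g x by exact: near_open oU Ux fg.
split=> [x Ux|]; first exact: near_eq_derivable (fgx x Ux) (dfi x Ux).
by apply: IH sfi => x Ux; exact: near_eq_derive (fgx x Ux).
Qed.

Lemma Ck_on_cst U k (a : R) : Ck_on U k (cst a).
Proof.
elim: k a => [|k IH] a; (split; first by move=> x _; exact: cst_continuous) => //.
move=> i; split=> [x _|]; first exact: derivable_cst.
have -> : (fun x : 'rV[R]_n => 'D_(delta_mx 0 i) (cst a) x) = cst 0.
  by apply/funext => x; rewrite derive_cst.
exact: IH.
Qed.

Lemma Ck_onD U k f g : open U ->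
  Ck_on U k f -> Ck_on U k g -> Ck_on U k (f + g).
Proof.
move=> oU; elim: k f g => [|k IH] f g [cf df] [cg dg]; split=> //.
1,2: by move=> x Ux; apply: continuousD; [exact: cf|exact: cg].
move=> i; have [dfi sfi] := df i; have [dgi sgi] := dg i.
split=> [x Ux|]; first by apply: derivableD; [exact: dfi|exact: dgi].
apply: Ck_on_ext (IH _ _ sfi sgi) => // x Ux.
by rewrite (deriveD (dfi x Ux) (dgi x Ux)).
Qed.

Lemma Ck_onM U k f g : open U ->
  Ck_on U k f -> Ck_on U k g -> Ck_on U k (f * g).
Proof.
move=> oU; elim: k f g => [|k IH] f g Cf Cg.
  have [cf _] := Cf; have [cg _] := Cg; split=> // x Ux.
  by apply: continuousM; [exact: cf|exact: cg].
have [cf df] := Cf; have [cg dg] := Cg.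
split=> [x Ux|i]; first by apply: continuousM; [exact: cf|exact: cg].
have [dfi sfi] := df i; have [dgi sgi] := dg i.
split=> [x Ux|]; first by apply: derivableM; [exact: dfi|exact: dgi].
have := Ck_onD oU (IH _ _ (Ck_onW Cf) sgi) (IH _ _ (Ck_onW Cg) sfi).
apply: Ck_on_ext => // x Ux.
by rewrite (deriveM (dfi x Ux) (dgi x Ux)).
Qed.

End SmoothOn.

(* A local chart with values in R^n.  [chart_inv] is only meaningful on
   [chart_codom], the open image of the chart. *)
Record chart (R : realType) (n : nat) (M : topologicalType) := Chart {
  chart_dom : set M;
  chart_codom : set 'rV[R]_n;
  chart_map : M -> 'rV[R]_n;
  chart_inv : 'rV[R]_n -> M;
  chart_dom_open : open chart_dom;
  chart_codom_open : open chart_codom;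
  chart_map_codom : forall p, chart_dom p -> chart_codom (chart_map p);
  chart_inv_dom : forall x, chart_codom x -> chart_dom (chart_inv x);
  chart_mapK : forall p, chart_dom p -> chart_inv (chart_map p) = p;
  chart_invK : forall x, chart_codom x -> chart_map (chart_inv x) = x;
  chart_map_continuous : forall p, chart_dom p -> {for p, continuous chart_map};
  chart_inv_continuous : forall x, chart_codom x -> {for x, continuous chart_inv}
}.

Arguments chart_dom_open {R n M} c : rename.
Arguments chart_codom_open {R n M} c : rename.

(* The chart change (d o c^-1) is smooth on c(dom c `&` dom d). *)
Definition smooth_transition (R : realType) (n : nat) (M : topologicalType)
    (c d : chart R n M) : Prop :=
  forall i : 'I_n,
    smooth_on (chart_codom c `&` chart_inv c @^-1` chart_dom d)
              (fun x => chart_map d (chart_inv c x) 0 i).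

(* Smooth n-dimensional manifold (without boundary); the atlas need not be
   maximal. *)
Record smoothManifold (R : realType) (n : nat) := SmoothManifold {
  manifold_carrier :> topologicalType;
  manifold_hausdorff : hausdorff_space manifold_carrier;
  manifold_countable : @second_countable manifold_carrier;
  atlas : set (chart R n manifold_carrier);
  atlas_cover : forall p, exists2 c, atlas c & chart_dom c p;
  atlas_compatible : forall c d, atlas c -> atlas d -> smooth_transition c d
}.

Section SmoothFunctions.
Context {R : realType} {n : nat} (M : smoothManifold R n).

Definition smooth_pred : {pred M -> R} := fun f =>
  `[< forall c, atlas c -> smooth_on (chart_codom c) (f \o chart_inv c) >].

Record smoothFun := SmoothFun {
  smooth_fun :> M -> R;
  smooth_funP : smooth_fun \in smooth_pred
}.

HB.instance Definition _ := [isSub for smooth_fun].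
HB.instance Definition _ := [Choice of smoothFun by <:].

Lemma smooth_predZ_subproof :
  (forall (a : R) (f : M -> R), f \in smooth_pred -> a *: f \in smooth_pred).
Proof.
move=> a f /asboolP sf; apply/asboolP => c ac k.
have := Ck_onM (chart_codom_open c) (Ck_on_cst (chart_codom c) k a) (sf c ac k).
exact.
Qed.

Lemma smooth_pred_subring : subring_closed smooth_pred.
Proof.
split.
- by apply/asboolP => c _ k; exact: Ck_on_cst.
- move=> f g sf sg; rewrite -scaleN1r.
  have /asboolP sg' := smooth_predZ_subproof (-1) sg.
  move/asboolP: sf => sf; apply/asboolP => c ac k.
  exact: (Ck_onD (chart_codom_open c) (sf c ac k) (sg' c ac k)).
- move=> f g /asboolP sf /asboolP sg; apply/asboolP => c ac k.
  exact: (Ck_onM (chart_codom_open c) (sf c ac k) (sg c ac k)).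
Qed.

HB.instance Definition _ :=
  GRing.isSubringClosed.Build _ smooth_pred smooth_pred_subring.
HB.instance Definition _ :=
  GRing.isScaleClosed.Build _ _ smooth_pred smooth_predZ_subproof.
HB.instance Definition _ := GRing.SubChoice_isSubComPzRing.Build
  (M -> R) smooth_pred smoothFun smooth_pred_subring.
HB.instance Definition _ := [SubZmodule_isSubLmodule of smoothFun by <:].

Lemma smoothFun_scaleAl (a : R) (f g : smoothFun) : a *: (f * g) = a *: f * g.
Proof. by apply/val_inj/funext => p /=; rewrite -mulrA. Qed.

Lemma smoothFun_scaleAr (a : R) (f g : smoothFun) : a *: (f * g) = f * (a *: g).
Proof. by rewrite mulrC smoothFun_scaleAl mulrC. Qed.

End SmoothFunctions.

Section VectorFields.
Context {R : realType} {n : nat} (M : smoothManifold R n).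
Local Notation Coo := (smoothFun M).

Definition derivation_pred : {pred Coo -> Coo^o} := fun X =>
  `[< (forall (a : R) (f g : Coo), X (a *: f + g) = a *: (X f : Coo) + X g) /\
      (forall f g : Coo, X (f * g) = X f * g + f * X g) >].

(* Smooth vector fields are the derivations f |-> A f of the R-algebra of
   smooth functions. *)
Record vfield := VField {
  vfield_fun :> Coo -> Coo^o;
  vfieldP : vfield_fun \in derivation_pred
}.

HB.instance Definition _ := [isSub for vfield_fun].
HB.instance Definition _ := [Choice of vfield by <:].

Lemma derivation_submod : submod_closed derivation_pred.
Proof.
split.
  apply/asboolP; split=> [a f g|f g]; first by rewrite /= scaler0 addr0.
  by rewrite /= mul0r mulr0 addr0.
move=> h X Y /asboolP[lX mX] /asboolP[lY mY]; apply/asboolP.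
have E f : (h *: X + Y) f = h * (X f : Coo) + Y f :> Coo by [].
split=> [a f g|f g]; rewrite !E.
  by rewrite lX lY mulrDr -smoothFun_scaleAr scalerDr addrACA.
rewrite mX mY !mulrDr !mulrDl !mulrA (mulrC h f) -!mulrA.
by rewrite addrACA.
Qed.

HB.instance Definition _ :=
  GRing.isSubmodClosed.Build _ _ derivation_pred derivation_submod.
HB.instance Definition _ := [SubChoice_isSubLmodule of vfield by <:].

Lemma vfield_ext (A B : vfield) : (forall f : Coo, A f = B f) -> A = B.
Proof. by move=> AB; exact/val_inj/funext. Qed.

Lemma vfield_addE (A B : vfield) (f : Coo) : (A + B) f = (A f : Coo) + B f.
Proof. by []. Qed.

Lemma vfield_zeroE (f : Coo) : (0 : vfield) f = 0.
Proof. by []. Qed.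

Lemma vfield_oppE (A : vfield) (f : Coo) : (- A) f = - (A f : Coo).
Proof. by []. Qed.

Lemma vfield_scaleE (h : Coo) (A : vfield) (f : Coo) :
  (h *: A) f = h * (A f : Coo).
Proof. by []. Qed.

Definition vfieldE :=
  (vfield_zeroE, vfield_addE, vfield_oppE, vfield_scaleE).

Lemma vfield_linear (A : vfield) (a : R) (f g : Coo) :
  A (a *: f + g) = a *: (A f : Coo) + A g.
Proof. by have /asboolP[] := vfieldP A. Qed.

Lemma vfield_leibniz (A : vfield) (f g : Coo) : A (f * g) = A f * g + f * A g.
Proof. by have /asboolP[] := vfieldP A. Qed.

Lemma vfieldD (A : vfield) (f g : Coo) : A (f + g) = A f + A g.
Proof. by have := vfield_linear A 1 f g; rewrite !scale1r. Qed.

Lemma vfield_bracket_subproof (A B : vfield) :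
  (fun f : Coo => A (B f) - B (A f) : Coo^o) \in derivation_pred.
Proof.
apply/asboolP; split=> [a f g|f g].
  by rewrite !vfield_linear scalerBr opprD addrACA.
rewrite !vfield_leibniz !vfieldD !vfield_leibniz /=; ring.
Qed.

(* [A, B]_- := A o B - B o A *)
Definition vfield_bracket (A B : vfield) : vfield :=
  VField (vfield_bracket_subproof A B).

End VectorFields.

Section Connections.
Context {R : realType} {n : nat} {M : smoothManifold R n}.
Local Notation Coo := (smoothFun M).
Local Notation X := (vfield M).

Record connection := Connection {
  cov :> X -> X -> X;
  cov_linear : forall (f : Coo) (A A' B : X),
    cov (f *: A + A') B = f *: cov A B + cov A' B;
  cov_additive : forall A B B' : X, cov A (B + B') = cov A B + cov A B';
  cov_leibniz : forall (f : Coo) (A B : X),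
    cov A (f *: B) = (A f : Coo) *: B + f *: cov A B
}.

(* Tensor fields of type (1,2), as maps of vector fields which are bilinear
   over the smooth functions. *)
Definition tensor12_pred : {pred X -> X -> X} := fun S =>
  `[< (forall (f : Coo) (A A' B : X),
         S (f *: A + A') B = f *: S A B + S A' B) /\
      (forall (f : Coo) (A B B' : X),
         S A (f *: B + B') = f *: S A B + S A B') >].

Record tensor12 := Tensor12 {
  tensor12_fun :> X -> X -> X;
  tensor12P : tensor12_fun \in tensor12_pred
}.

HB.instance Definition _ := [isSub for tensor12_fun].
HB.instance Definition _ := [Choice of tensor12 by <:].

Lemma tensor12_submod : submod_closed tensor12_pred.
Proof.
split.
  by apply/asboolP; split=> f A A' B /=; rewrite scaler0 addr0.
move=> h S S' /asboolP[Sl Sr] /asboolP[S'l S'r]; apply/asboolP.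
have E A B : (h *: S + S') A B = h *: S A B + S' A B by [].
by split=> f A A' B; rewrite !E (Sl, Sr) (S'l, S'r) !scalerDr !scalerA
  (mulrC h) addrACA.
Qed.

HB.instance Definition _ :=
  GRing.isSubmodClosed.Build _ _ tensor12_pred tensor12_submod.
HB.instance Definition _ := [SubChoice_isSubLmodule of tensor12 by <:].

Lemma tensor12_linl (S : tensor12) (f : Coo) (A A' B : X) :
  S (f *: A + A') B = f *: S A B + S A' B.
Proof. by have /asboolP[] := tensor12P S. Qed.

Lemma tensor12_linr (S : tensor12) (f : Coo) (A B B' : X) :
  S A (f *: B + B') = f *: S A B + S A B'.
Proof. by have /asboolP[] := tensor12P S. Qed.

Lemma vfield_bracketC (A B : X) : vfield_bracket A B = - vfield_bracket B A.
Proof.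
apply/val_inj/funext => f; rewrite [RHS]/= -[RHS]/(- (B (A f) - A (B f))).
by rewrite opprB.
Qed.

Lemma vfield_bracket_linr (f : Coo) (A B B' : X) :
  vfield_bracket A (f *: B + B') =
  (A f : Coo) *: B + f *: vfield_bracket A B + vfield_bracket A B'.
Proof.
apply/val_inj/funext => g.
rewrite -[LHS]/(A (f * B g + B' g) - (f * B (A g) + B' (A g))).
rewrite -[RHS]/(A f * B g + f * (A (B g) - B (A g)) + (A (B' g) - B' (A g))).
by rewrite vfieldD vfield_leibniz /=; ring.
Qed.

Variable nabla : connection.

Lemma torsion_subproof :
  (fun A B => nabla A B - nabla B A - vfield_bracket A B) \in tensor12_pred.
Proof.
have linr (f : Coo) (A B B' : X) :
    nabla A (f *: B + B') - nabla (f *: B + B') A -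
      vfield_bracket A (f *: B + B') =
    f *: (nabla A B - nabla B A - vfield_bracket A B) +
      (nabla A B' - nabla B' A - vfield_bracket A B').
  rewrite cov_linear cov_additive cov_leibniz vfield_bracket_linr.
  by apply: vfield_ext => g; rewrite !vfieldE; ring.
have sym (A B : X) : nabla A B - nabla B A - vfield_bracket A B =
    - (nabla B A - nabla A B - vfield_bracket B A).
  by rewrite (vfield_bracketC B A); apply: vfield_ext => g; rewrite !vfieldE; ring.
apply/asboolP; split=> [f A A' B|f A B B'] //.
by rewrite !(sym _ B) linr opprD scalerN.
Qed.

(* T(A, B) := nabla_A B - nabla_B A - [A, B]_- *)
Definition torsion : tensor12 := Tensor12 torsion_subproof.

Lemma cov_tensor_subproof (A : X) (S : tensor12) :
  (fun C D => nabla A (S C D) - S (nabla A C) D - S C (nabla A D))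
    \in tensor12_pred.
Proof.
apply/asboolP; split=> [f C C' D|f C D D'].
  rewrite !(cov_leibniz, cov_additive, tensor12_linl).
  rewrite -[_ *: C + _ + _]addrA !tensor12_linl.
  by apply: vfield_ext => g; rewrite !vfieldE; ring.
rewrite !(cov_leibniz, cov_additive, tensor12_linr).
rewrite -[_ *: D + _ + _]addrA !tensor12_linr.
by apply: vfield_ext => g; rewrite !vfieldE; ring.
Qed.

(* The extension of nabla_A to tensor fields of type (1,2):
   (nabla_A S)(C, D) = nabla_A (S(C, D)) - S(nabla_A C, D) - S(C, nabla_A D). *)
Definition cov_tensor (A : X) (S : tensor12) : tensor12 :=
  Tensor12 (cov_tensor_subproof A S).

(* R(A, B) := D_A o D_B - D_B o D_A - D_[A, B]_-, for a covariant derivative D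
   acting on a space E of tensor fields. *)
Definition curvature (E : zmodType) (D : X -> E -> E) (A B : X) (e : E) : E :=
  D A (D B e) - D B (D A e) - D (vfield_bracket A B) e.

End Connections.

Arguments connection {R n} M.
Arguments tensor12 {R n} M.

Definition cyclic_sum4 (T : Type) (V : zmodType) (F : T -> T -> T -> T -> V)
    (a b c d : T) : V :=
  F a b c d + F b c d a + F c d a b + F d a b c.

(* Main.v *)
(** The summand vanishes before any cyclic summation: a commutator of
    derivations of the pairing [(S, C, D) |-> S(C, D)] is again a derivation of
    it, so [R(A, B)(S(C, D))] obeys the Leibniz rule for every (1,2)-tensor
    field [S]. *)
Require Import Defs.
From mathcomp Require Import all_boot all_order all_algebra ring.
From mathcomp Require Import all_classical all_reals all_analysis.
Import GRing.Theory.
Local Open Scope ring_scope.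

Section CurvatureDerivation.
Context {R : realType} {n : nat} {M : smoothManifold R n}.
Implicit Types (A B C D : vfield M) (S : tensor12 M).

Lemma tensor12Dl S A B C : S (A + B) C = S A C + S B C.
Proof. by have := tensor12_linl S 1 A B C; rewrite !scale1r. Qed.

Lemma tensor12Dr S A B C : S A (B + C) = S A B + S A C.
Proof. by have := tensor12_linr S 1 A B C; rewrite !scale1r. Qed.

(** Additivity forces the value 0 at 0; cancelling [S A B] then gives the sign. *)
Lemma tensor12Nl S A B : S (- A) B = - S A B.
Proof.
have S0 : S 0 B = 0 by apply: (addrI (S 0 B)); rewrite -tensor12Dl !addr0.
by apply: (addrI (S A B)); rewrite -tensor12Dl !subrr.
Qed.

Lemma tensor12Nr S A B : S A (- B) = - S A B.
Proof.
have S0 : S A 0 = 0 by apply: (addrI (S A 0)); rewrite -tensor12Dr !addr0.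
by apply: (addrI (S A B)); rewrite -tensor12Dr !subrr.
Qed.

Variable nabla : connection M.

Lemma covN A B : nabla A (- B) = - nabla A B.
Proof.
have c0 : nabla A 0 = 0.
  by apply: (addrI (nabla A 0)); rewrite -cov_additive !addr0.
by apply: (addrI (nabla A B)); rewrite -cov_additive !subrr.
Qed.

(** Holds by conversion; as an equation it lets rewriting unfold nested derivatives. *)
Lemma cov_tensorE A S C D :
  cov_tensor nabla A S C D = nabla A (S C D) - S (nabla A C) D - S C (nabla A D).
Proof. by []. Qed.

(** In the second derivative of [S], mixed terms such as [S (nabla A C) (nabla B D)] occur
    symmetrically in [A] and [B], so the commutator cancels them. The bracket term obeys the Leibniz
    rule by definition. *)
Lemma curvature_leibniz A B S C D :
  curvature nabla A B (S C D) =
  curvature (cov_tensor nabla) A B S C D +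
  S (curvature nabla A B C) D + S C (curvature nabla A B D).
Proof.
(* Subtraction of tensor fields is pointwise. *)
have -> : curvature (cov_tensor nabla) A B S C D =
    cov_tensor nabla A (cov_tensor nabla B S) C D -
    cov_tensor nabla B (cov_tensor nabla A S) C D -
    cov_tensor nabla (vfield_bracket A B) S C D by [].
rewrite /curvature !(cov_tensorE, tensor12Dl, tensor12Dr, tensor12Nl, tensor12Nr,
  cov_additive, covN).
(* Applying both sides to [f] moves the identity into the commutative ring of smooth functions,
   where [ring] applies. *)
by apply: vfield_ext => f; rewrite !vfieldE; ring.
Qed.

End CurvatureDerivation.

Theorem mainTheorem3 (R : realType) (n : nat) (M : smoothManifold R n)
    (nabla : connection M) (A B C D : vfield M) :
  let T := torsion nabla in
  let RX := curvature nabla in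
  let RT := curvature (cov_tensor nabla) in
  cyclic_sum4
    (fun A B C D : vfield M =>
       RX A B (T C D) - (RT A B T) C D - T (RX A B C) D - T C (RX A B D))
    A B C D = 0.
Proof.
move=> T RX RT.
have summand0 A' B' C' D' : RX A' B' (T C' D') - (RT A' B' T) C' D' -
    T (RX A' B' C') D' - T C' (RX A' B' D') = 0.
  (* The Leibniz rule with [S] the torsion. *)
  have -> : RX A' B' (T C' D') =
      (RT A' B' T) C' D' + T (RX A' B' C') D' + T C' (RX A' B' D').
    exact: curvature_leibniz.
  move: ((RT A' B' T) C' D') (T (RX A' B' C') D') (T C' (RX A' B' D')).
  by move=> x y z; rewrite -addrA -opprD -addrA -opprD addrA subrr.
by rewrite /cyclic_sum4 !summand0 !addr0.
Qed.
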